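(* Let $X$ be a nonzero real, separable, reflexive Banach space, let $Y$ be a nonzero real separable Hilbert space with dual $Y'$, and let $A\in L(X,Y')$ be a bounded linear operator. Then the following are equivalent: (i) there exists $\gamma>0$ such that $$\inf_{y\in Y\setminus\{0\}}\ \sup_{x\in X\setminus\{0\}}\frac{\langle Ax,y\rangle}{\|x\|_X\|y\|_Y}=\inf_{x\in X\setminus\{0\}}\ \sup_{y\in Y\setminus\{0\}}\frac{\langle Ax,y\rangle}{\|x\|_X\|y\|_Y}=\gamma;$$ (ii) there exists a surjective $\Phi\in L(X,Y)$ such that $$\liminf_{x\in X,\ \|x\|_X\to\infty}\frac{\langle Ax,\Phi x\rangle}{\|x\|_X}=+\infty.$$
   Context: $\langle\cdot,\cdot\rangle$ denotes the duality pairing between $Y'$ and $Y$; $L(\cdot,\cdot)$ denotes bounded linear operators. The condition in (ii) means: for every $K>0$ there is $R>0$ such that $\langle Ax,\Phi x\rangle\ge K\|x\|_X$ for all $x\in X$ with $\|x\|_X\ge R$. *)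

(* Defs.v *)
From HB Require Import structures.
From mathcomp Require Import all_boot all_order all_algebra.
From mathcomp Require Import all_classical all_reals all_analysis.

Set Implicit Arguments.
Unset Strict Implicit.
Unset Printing Implicit Defensive.

Import Order.TTheory GRing.Theory Num.Theory.
Import numFieldNormedType.Exports.

Local Open Scope classical_set_scope.
Local Open Scope ring_scope.

Section BoundedOperators.
Variables (R : realType) (V W : normedModType R).

(* By [linear_bounded_continuous], a linear map between normed modules is
   bounded if and only if it is continuous. *)
Definition blin_pred : {pred V -> W} :=
  mem [set f : V -> W | linear f /\ continuous f].

Record blin : Type := Blin { blin_fun :> V -> W ; _ : blin_fun \in blin_pred }.

HB.instance Definition _ := [isSub for blin_fun].
HB.instance Definition _ := [Choice of blin by <:].

Lemma blin_submod_closed : submod_closed blin_pred.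
Proof.
split.
  rewrite inE; split; last exact: cst_continuous.
  by move=> a x y; rewrite /= /GRing.zero/= scaler0 addr0.
move=> a f g; rewrite !inE => -[fl fc] [gl gc]; split.
  move=> b x y; rewrite !fctE /= fl gl !scalerDr !scalerA mulrC -!addrA.
  by congr (_ + _); rewrite addrCA.
by move=> x; apply: cvgD; [apply: cvgZl_tmp; exact: fc|exact: gc].
Qed.

HB.instance Definition _ :=
  GRing.isSubmodClosed.Build R (V -> W) blin_pred blin_submod_closed.
HB.instance Definition _ := [SubChoice_isSubLmodule of blin by <:].

Lemma blin_linear (f : blin) : linear f.
Proof. by case: f => f /= /[!inE] -[]. Qed.

Lemma blin_continuous (f : blin) : continuous f.
Proof. by case: f => f /= /[!inE] -[]. Qed.

HB.instance Definition _ (f : blin) :=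
  GRing.isLinear.Build R V W *:%R f (blin_linear f).

Definition opnorm (f : blin) : R := sup [set `|f x| | x in [set x | `|x| <= 1]].

Lemma opnorm_has_sup (f : blin) :
  has_sup [set `|f x| | x in [set x | `|x| <= 1]].
Proof.
split; first by exists `|f 0|; exists 0 => //=; rewrite normr0.
have /linear_bounded_continuous/bounded_funP/(_ 1)[M fM] := @blin_continuous f.
by exists M => _ [x /= /fM + <-].
Qed.

Lemma ler_opnorm1 (f : blin) (x : V) : `|x| <= 1 -> `|f x| <= opnorm f.
Proof. by move=> x1; apply: (sup_upper_bound (opnorm_has_sup f)); exists x. Qed.

Lemma opnorm_le (f : blin) (M : R) :
  (forall x, `|x| <= 1 -> `|f x| <= M) -> opnorm f <= M.
Proof.
move=> fM; apply: ge_sup; first by case: (opnorm_has_sup f).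
by move=> _ [x /= /fM + <-].
Qed.

Lemma opnorm_ge0 (f : blin) : 0 <= opnorm f.
Proof. by apply: le_trans (@ler_opnorm1 f 0 _); rewrite ?normr0. Qed.

Lemma ler_opnorm (f : blin) (x : V) : `|f x| <= opnorm f * `|x|.
Proof.
have [->|x0] := eqVneq x 0; first by rewrite linear0 !normr0 mulr0.
have nx : 0 < `|x| by rewrite normr_gt0.
have := @ler_opnorm1 f (`|x|^-1 *: x).
rewrite normfZV// => /(_ (lexx _)).
by rewrite linearZ normrZ normfV normr_id mulrC ler_pdivrMr.
Qed.

Let opnormD (f g : blin) : opnorm (f + g) <= opnorm f + opnorm g.
Proof.
apply: opnorm_le => x x1.
rewrite [X in `|X|](_ : _ = f x + g x)//.
by apply: le_trans (ler_normD _ _) _; apply: lerD; exact: ler_opnorm1.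
Qed.

Let opnormZ (a : R) (f : blin) : opnorm (a *: f) = `|a| * opnorm f.
Proof.
have le b (g : blin) : opnorm (b *: g) <= `|b| * opnorm g.
  apply: opnorm_le => x x1; rewrite [X in `|X|](_ : _ = b *: g x)// normrZ.
  by rewrite ler_wpM2l//; exact: ler_opnorm1.
apply/eqP; rewrite eq_le le /=.
have [->|a0] := eqVneq a 0; first by rewrite normr0 mul0r opnorm_ge0.
rewrite -[in leLHS](scalerK a0 f) -ler_pdivlMl ?normr_gt0// -normfV.
exact: le.
Qed.

Let opnorm0_eq0 (f : blin) : opnorm f = 0 -> f = 0.
Proof.
move=> f0; apply: val_inj; apply/funext => x /=.
apply/eqP; rewrite -normr_le0.
by have := ler_opnorm f x; rewrite f0 mul0r.
Qed.

HB.instance Definition _ :=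
  Lmodule_isNormed.Build R blin opnormD opnormZ opnorm0_eq0.

Lemma blin_normE (f : blin) : `|f| = opnorm f.
Proof. by []. Qed.

End BoundedOperators.

Notation "''L' ( V , W )" := (blin V W)
  (at level 8, format "''L' ( V ,  W )") : type_scope.

Definition dual (R : realType) (V : normedModType R) : normedModType R :=
  'L(V, R^o).

Definition pairing (R : realType) (V : normedModType R) (f : dual V) (v : V) : R :=
  (f : 'L(V, R^o)) v.

Definition separable (T : topologicalType) : Prop :=
  exists D : set T, countable D /\ dense D.

(* Surjectivity of the canonical embedding of V into its bidual. *)
Definition reflexive_space (R : realType) (V : normedModType R) : Prop :=
  forall phi : dual (dual V), exists v : V,
    forall f : dual V, pairing phi f = pairing f v.

Definition norm_infty (R : realType) (V : normedModType R) : set_system V :=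
  filter_from [set: R] (fun r => [set x : V | r <= `|x|]).

#[global] Instance norm_infty_filter (R : realType) (V : normedModType R) :
  Filter (@norm_infty R V).
Proof.
apply: filter_from_filter; first by exists 0.
move=> r s _ _; exists (Num.max r s) => // x /=.
by rewrite ge_max => /andP[].
Qed.

Lemma liminf_quotient_normP (R : realType) (V : normedModType R) (q : V -> R) :
  limf_einf (fun x => (q x / `|x|)%:E) (@norm_infty R V) = +oo%E <->
  forall K : R, 0 < K -> exists2 r : R, 0 < r &
    forall x : V, r <= `|x| -> K * `|x| <= q x.
Proof.
rewrite limf_einfE; split=> [supE K K0|coer].
  have : (K%:E < ereal_sup [set ereal_inf ((fun x => (q x / `|x|)%:E) @` U) |
                              U in @norm_infty R V])%E by rewrite supE ltry.
  move=> /ereal_sup_gt[_ [U [r _ rU] <-] KU].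
  exists (Num.max r 1) => [|x]; first by rewrite lt_max ltr01 orbT.
  rewrite ge_max => /andP[rx x1].
  have x0 : 0 < `|x| by rewrite (lt_le_trans ltr01).
  rewrite -ler_pdivlMr// -lee_fin (le_trans (ltW KU))//.
  by apply: ereal_inf_lbound; exists x => //; exact: rU.
apply/eqyP => K K0.
have [r r0 qr] := coer K K0.
apply: (@le_trans _ _ (ereal_inf
  ((fun x => (q x / `|x|)%:E) @` [set x : V | r <= `|x|]))).
  apply: le_ereal_inf_tmp => _ [x /= rx <-].
  by rewrite lee_fin ler_pdivlMr ?(lt_le_trans r0)//; exact: qr.
by apply: ereal_sup_ubound; exists [set x : V | r <= `|x|] => //; exists r.
Qed.

(* Main.v *)
Require Import Defs.
From HB Require Import structures.
From mathcomp Require Import all_boot all_order all_algebra.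
From mathcomp Require Import all_classical all_reals all_analysis.
From mathcomp Require Import ring lra.

Set Implicit Arguments.
Unset Strict Implicit.
Unset Printing Implicit Defensive.

Import Order.TTheory GRing.Theory Num.Theory.
Import numFieldNormedType.Exports.

Local Open Scope classical_set_scope.
Local Open Scope ring_scope.

(** By the Riesz theorem, A is represented by a bounded operator T : X -> Y with
    <A x, y> = ip (T x) y. Cauchy-Schwarz turns the infimum over x into the best
    constant c with c |x| <= |T x|, and the infimum over y is, by definition, the
    best constant c with c |y| <= |T^* y|, the norm of T^* y being taken in the
    dual of X.

    If the first constant is positive, T is injective with closed range; if the
    second is positive too, nothing is orthogonal to the range, so T is onto.
    Hence (i) gives (ii) with Phi := T, since <A x, T x> = |T x|^2 grows
    quadratically.

    Conversely, the growth condition on one large sphere and the homogeneity of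
    <A x, Phi x> give |x|^2 <= r <A x, Phi x> for some r. Boundedness of Phi
    then bounds T below, and its surjectivity, which writes any y as Phi x,
    bounds T^* below. It remains to see that the two best constants coincide
    ([bounded_below_adjoint]), that is, that the inverses of T and of T^* have
    the same norm. Since the norm of X is arbitrary, this needs a separation
    argument, carried out inside Y, between the point T x and the image under T
    of a ball of X that excludes x.

    The Riesz theorem, the surjectivity of T and this separation all come from a
    single projection result, [best_approximation]: for T bounded below on a
    complete space, every point of Y has a best approximation in the image of a
    closed convex set, characterized by the usual variational inequality. *)

(** * Inner products inducing the norm *)

Section InnerProduct.
Variables (R : realType) (Y : normedModType R).
Variable ip : {dot Y for (idfun : R -> R)}.
Hypothesis ip_norm : forall y : Y, ip y y = `|y| ^+ 2.

Lemma ipC (u v : Y) : ip u v = ip v u.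
Proof. by rewrite hermC expr0 mul1r. Qed.

Lemma ipDl (u v w : Y) : ip (u + v) w = ip u w + ip v w.
Proof. by rewrite linearDl. Qed.

Lemma ipBl (u v w : Y) : ip (u - v) w = ip u w - ip v w.
Proof. by rewrite linearBl. Qed.

Lemma ipBr (u v w : Y) : ip u (v - w) = ip u v - ip u w.
Proof. by rewrite linearBr. Qed.

Lemma ipNr (u v : Y) : ip u (- v) = - ip u v.
Proof. by rewrite linearNr. Qed.

Lemma ipZr (u v : Y) (t : R) : ip u (t *: v) = t * ip u v.
Proof. by rewrite linearZr_LR. Qed.

Lemma ipZl (u v : Y) (t : R) : ip (t *: u) v = t * ip u v.
Proof. by rewrite ipC ipZr ipC. Qed.

Lemma norm_subZ_sqr (u v : Y) (t : R) :
  `|u - t *: v| ^+ 2 = `|u| ^+ 2 - 2 * t * ip u v + t ^+ 2 * `|v| ^+ 2.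
Proof.
rewrite -!ip_norm ipBl !ipBr !ipZl !ipZr (ipC v u).
ring.
Qed.

Lemma cauchy_schwarz (u v : Y) : ip u v <= `|u| * `|v|.
Proof.
have [->|v0] := eqVneq v 0; first by rewrite linear0r normr0 mulr0.
have nv : 0 < `|v| by rewrite normr_gt0.
have := sqr_ge0 `|u - (ip u v / `|v| ^+ 2) *: v|.
have -> : `|u - (ip u v / `|v| ^+ 2) *: v| ^+ 2 =
    `|u| ^+ 2 - (ip u v) ^+ 2 / `|v| ^+ 2.
  by rewrite norm_subZ_sqr; field; rewrite gt_eqF.
rewrite subr_ge0 ler_pdivrMr ?exprn_gt0// -exprMn => uv.
apply: le_trans (ler_norm _) _.
by rewrite -(@ler_pXn2r _ 2) ?nnegrE ?mulr_ge0// real_normK ?num_real.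
Qed.

(** Apollonius' median identity, the form of the parallelogram law that bounds
    the distance of two near-minimizers of |z - .| through their midpoint. *)
Lemma apollonius (z u v : Y) :
  `|u - v| ^+ 2 = 2 * `|z - u| ^+ 2 + 2 * `|z - v| ^+ 2
    - 4 * `|z - (u + 2^-1 *: (v - u))| ^+ 2.
Proof.
have vu : v - u = (z - u) - (z - v) by rewrite opprB [RHS]addrC subrKA.
rewrite distrC opprD addrA norm_subZ_sqr vu ipBr ip_norm.
have := norm_subZ_sqr (z - u) (z - v) 1; rewrite scale1r => ->.
by field.
Qed.

End InnerProduct.

(** * Best approximation in images of closed convex sets *)

Section BestApproximation.
Variables (R : realType) (X : completeNormedModType R) (Y : normedModType R).
Variable ip : {dot Y for (idfun : R -> R)}.
Hypothesis ip_norm : forall y : Y, ip y y = `|y| ^+ 2.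

(** The sets of near-minimizers of |z - T x| over D generate a Cauchy filter on
    X: their images have small diameter by [apollonius], and T is bounded below.
    Its limit is a minimizer, and moving from it towards any other point of D
    cannot decrease the distance, whence the inequality. The limit is taken in
    X, where completeness and the closedness of D are at hand. *)
Lemma best_approximation (T : {linear X -> Y}) (a : R) (D : set X) (z : Y) :
    continuous T -> 0 < a -> (forall x, a * `|x| <= `|T x|) ->
    D !=set0 -> closed D ->
    (forall u v t, D u -> D v -> 0 <= t <= 1 -> D (u + t *: (v - u))) ->
  exists2 p, D p & forall u, D u -> ip (z - T p) (T u - T p) <= 0.
Proof.
move=> Tcont a0 Tbelow [x0 Dx0] Dclosed Dconvex.
pose E := [set `|z - T x| ^+ 2 | x in D].
have infE : has_inf E.
  split; first by exists (`|z - T x0| ^+ 2), x0.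
  by exists 0 => _ [x _ <-]; exact: sqr_ge0.
pose d := inf E.
have dle x : D x -> d <= `|z - T x| ^+ 2.
  by move=> Dx; apply: ge_inf; [case: infE|exists x].
pose N e := [set x | D x /\ `|z - T x| ^+ 2 <= d + e].
have Nfilter : Filter (filter_from [set e : R | 0 < e] N).
  apply: filter_from_filter; first by exists 1 => /=.
  move=> e f e0 f0; exists (Num.min e f) => /= [|x [Dx xef]].
    by rewrite lt_min e0.
  by split; split=> //; apply: le_trans xef _; rewrite lerD2l ge_min lexx ?orbT.
have Nproper : ProperFilter (filter_from [set e : R | 0 < e] N).
  apply: filter_from_proper => e /= e0.
  have [_ [x Dx <-] xe] := inf_adherent e0 infE.
  by exists x; split=> //; exact: ltW.
have Nclose e x y : N e x -> N e y -> `|T x - T y| ^+ 2 <= 4 * e.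
  move=> [Dx xe] [Dy ye]; rewrite (apollonius ip_norm z).
  have /dle : D (x + 2^-1 *: (y - x)) by apply: Dconvex => //; lra.
  rewrite linearD linearZ linearB /=; lra.
have Ncauchy : cauchy (filter_from [set e : R | 0 < e] N).
  apply: cauchy_exP => e e0.
  (* |T x - T y|^2 <= 4 f is then below (a e)^2, so that |x - y| < e *)
  pose f := (a * e / 4) ^+ 2.
  have f0 : 0 < f by rewrite exprn_gt0 ?divr_gt0 ?mulr_gt0.
  have [_ [x Dx <-] xf] := inf_adherent f0 infE.
  exists x; exists f => // y Ny.
  have /Nclose/(_ Ny) : N f x by split=> //; exact: ltW.
  rewrite -ball_normE /= => xy.
  rewrite -(ltr_pM2l a0); apply: le_lt_trans (Tbelow _) _.
  rewrite linearB -(@ltr_pXn2r _ 2) ?nnegrE ?(ltW (mulr_gt0 a0 e0))//.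
  apply: le_lt_trans xy _; rewrite /f.
  have : 0 < (a * e) ^+ 2 by rewrite exprn_gt0 ?mulr_gt0.
  by rewrite [(_ / 4) ^+ 2]exprMn; lra.
pose F := filter_from [set e : R | 0 < e] N.
have Np : F --> lim F by exact/cauchy_cvgP.
move: (lim F) Np => p Np.
have Dp : D p.
  apply: (@closed_cvg _ _ F Nproper id D Dclosed _ p Np).
  by exists 1 => //= x [].
have dp : `|z - T p| ^+ 2 <= d.
  apply/ler_addgt0Pr => e e0.
  have cvgN : `|z - T x| @[x --> F] --> `|z - T p|.
    apply: cvg_norm; apply: cvgB; first exact: cvg_cst.
    by apply: continuous_cvg => //; exact: Tcont.
  have cvgN2 : `|z - T x| ^+ 2 @[x --> F] --> `|z - T p| ^+ 2.
    by rewrite expr2; apply: cvgM.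
  apply: (@closed_cvg _ _ F Nproper _ _ (@closed_le R (d + e)) _ _ cvgN2).
  by exists e => // x [].
exists p => // u Du; rewrite leNgt; apply/negP.
set w := T u - T p; set s := ip _ _ => s0.
(* the step t (u - p) from p changes the squared distance to z by
   t (t n - 2 s); this t is at most 1 and makes t n <= s *)
pose n := `|w| ^+ 2.
have n0 : 0 <= n by exact: sqr_ge0.
pose t := Num.min 1 (s / (n + 1)).
have t0 : 0 < t by rewrite lt_min ltr01 divr_gt0// ltr_wpDl.
have /dle : D (p + t *: (u - p)).
  by apply: Dconvex => //; rewrite (ltW t0) ge_min lexx.
rewrite linearD linearZ linearB -/w opprD addrA (norm_subZ_sqr ip_norm).
rewrite -/n -/s => dt.
have : t * (2 * s - t * n) <= 0 by move: dp dt; rewrite expr2; lra.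
rewrite pmulr_rle0//.
have : t * n <= s.
  apply: (@le_trans _ _ (s / (n + 1) * n)).
    by rewrite ler_wpM2r// ge_min lexx orbT.
  by rewrite mulrAC ler_pdivrMr ?ltr_wpDl//; nra.
by lra.
Qed.

End BestApproximation.

(** * Riesz representation *)

Lemma bounded_linear_continuous (R : realType) (V W : normedModType R)
    (t : V -> W) (M : R) :
  linear t -> (forall x, `|t x| <= M * `|x|) -> continuous t.
Proof.
move=> tlin tM.
pose tL : {linear V -> W} := HB.pack t (GRing.isLinear.Build R V W *:%R t tlin).
apply: (proj1 (linear_bounded_continuous tL)); apply/linear_boundedP.
near=> r => x; apply: le_trans (tM x) _.
by rewrite ler_wpM2r//; near: r; exact: nbhs_pinfty_ge.
Unshelve. all: by end_near. Qed.

Section Riesz.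
Variables (R : realType) (Y : completeNormedModType R).
Variable ip : {dot Y for (idfun : R -> R)}.
Hypothesis ip_norm : forall y : Y, ip y y = `|y| ^+ 2.

Lemma ip_inj (u v : Y) : (forall y, ip u y = ip v y) -> u = v.
Proof.
move=> uv; apply/eqP; rewrite -subr_eq0 -normr_eq0 -sqrf_eq0 -ip_norm.
by rewrite ipBl uv subrr.
Qed.

(** The vector of least norm on the hyperplane f = 1 is orthogonal to the kernel
    of f, hence represents f up to a scalar. *)
Lemma riesz (f : dual Y) : exists u : Y, forall y, pairing f y = ip u y.
Proof.
rewrite /pairing.
have [f0|] := pselect (forall y, f y = 0).
  by exists 0 => y; rewrite f0 linear0l.
move=> /existsNP[y0 /eqP fy0].
have [p fp pmin] : exists2 p, f p = 1 &
    forall u, f u = 1 -> ip (0 - p) (u - p) <= 0.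
  apply: (best_approximation ip_norm (T := idfun) (a := 1)
    (D := f @^-1` [set 1])) => //.
  - by move=> ?; exact: cvg_id.
  - by move=> x; rewrite mul1r.
  - by exists ((f y0)^-1 *: y0); rewrite /= linearZ /= /GRing.scale /= mulVf.
  - apply: preimage_closed; last exact: closed_eq.
    by move=> x _; exact: blin_continuous.
  - move=> u v t /= fu fv _.
    by rewrite linearD linearZ linearB /= fu fv subrr scaler0 addr0.
have ker_le k : f k = 0 -> 0 <= ip p k.
  move=> fk; have := pmin (p + k); rewrite linearD /= fp fk addr0 => /(_ erefl).
  by rewrite addrAC subrr !add0r linearNl oppr_le0.
have ker_ortho k : f k = 0 -> ip p k = 0.
  move=> fk; apply/eqP; rewrite eq_le ker_le// andbT -oppr_ge0 -ipNr.
  by apply: ker_le; rewrite linearN /= fk oppr0.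
have p0 : p != 0.
  by apply: contra_eq_neq fp => ->; rewrite linear0 eq_sym oner_eq0.
exists ((`|p| ^- 2) *: p) => y; rewrite ipZl.
have : ip p (y - f y *: p) = 0.
  apply: ker_ortho.
  by rewrite linearB linearZ /= fp /GRing.scale /= mulr1 subrr.
rewrite ipBr ipZr ip_norm => /eqP; rewrite subr_eq0 => /eqP ->.
by rewrite mulrCA mulVf ?mulr1// expf_neq0 ?normr_eq0.
Qed.

Lemma riesz_operator (X : normedModType R) (A : 'L(X, dual Y)) :
  exists T : 'L(X, Y), forall x y, pairing (A x) y = ip (T x) y.
Proof.
have /choice[t tA] : forall x, exists u : Y, forall y, pairing (A x) y = ip u y.
  by move=> x; exact: riesz.
have tlin : linear t.
  move=> a x x'; apply: ip_inj => y.
  by rewrite ipDl ipZl -!tA linearD linearZ.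
have tbound x : `|t x| <= opnorm A * `|x|.
  have [->|tx0] := eqVneq (t x) 0.
    by rewrite normr0 mulr_ge0 ?opnorm_ge0.
  have tx : 0 < `|t x| by rewrite normr_gt0.
  rewrite -(ler_pM2r tx) -expr2 -ip_norm -tA /pairing.
  apply: le_trans (ler_norm _) _; apply: le_trans (ler_opnorm _ _) _.
  by rewrite ler_wpM2r// -blin_normE; exact: (ler_opnorm A).
have tcont : continuous t by exact: bounded_linear_continuous tlin tbound.
have tblin : t \in @blin_pred R X Y by rewrite inE.
by exists (Blin tblin).
Qed.

End Riesz.

(** * Lower bounds for an operator and its adjoint *)

Section AdjointPair.
Variables (R : realType) (X : completeNormedModType R) (Y : normedModType R).
Variable ip : {dot Y for (idfun : R -> R)}.
Hypothesis ip_norm : forall y : Y, ip y y = `|y| ^+ 2.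
Variable T : 'L(X, Y).

Definition bounded_below (c : R) := forall x, c * `|x| <= `|T x|.

(** The bound c |y| <= |T^* y|, where M ranges over the bounds of the functional
    T^* y = ip (T _) y on X. *)
Definition adjoint_bounded_below (c : R) := forall y M, y != 0 ->
  (forall x, ip (T x) y <= M * `|x|) -> c * `|y| <= M.

(** Brings [bounded_below] to the shape of [adjoint_bounded_below]: the
    functional ip (T x) _ has norm |T x|. *)
Lemma bounded_belowP (c : R) : (exists y : Y, y != 0) ->
  bounded_below c <->
  forall x M, x != 0 -> (forall y, ip (T x) y <= M * `|y|) -> c * `|x| <= M.
Proof.
move=> [y0 y0_neq0]; split=> [Tc x M _ xM|Tc x].
  apply: le_trans (Tc x) _; have [Tx0|Tx0] := eqVneq (T x) 0.
    have := xM y0; rewrite Tx0 linear0l normr0 pmulr_lge0//.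
    by rewrite normr_gt0.
  by have := xM (T x); rewrite ip_norm expr2 ler_pM2r// normr_gt0.
have [->|x0] := eqVneq x 0; first by rewrite linear0 !normr0 mulr0.
by apply: Tc => // y; exact: cauchy_schwarz.
Qed.

(** The error z - T p of the best approximation of z in the range of T is
    orthogonal to that range, hence vanishes by the bound on the adjoint. *)
Lemma bounded_below_surj (a b : R) : 0 < a -> 0 < b ->
  bounded_below a -> adjoint_bounded_below b -> forall z, exists x, T x = z.
Proof.
move=> a0 b0 Ta Tb z.
have [p _ pmin] : exists2 p, setT p &
    forall u, setT u -> ip (z - T p) (T u - T p) <= 0.
  apply: (best_approximation ip_norm (T := T) (a := a)) => //.
  - exact: blin_continuous.
  - by exists 0.
exists p; apply/esym/eqP; rewrite -subr_eq0; apply/negPn/negP => w0.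
have /(Tb _ 0 w0) : forall x, ip (T x) (z - T p) <= 0 * `|x|.
  move=> x; rewrite mul0r (ipC ip).
  have := pmin (p + x) I; rewrite (_ : T (p + x) - T p = T x)//.
  by rewrite linearD addrAC subrr add0r.
by rewrite leNgt mulr_gt0// normr_gt0.
Qed.

(** If T is an isomorphism, the best lower bounds of T and T^* agree. From T to
    T^*, test T^* y on the preimage x of y. From T^* to T, suppose that
    |T x| < c |x|: then x is outside the ball of radius r = |T x| / c, so T x is
    separated from the image of that ball by a vector w, for which
    r |T^* w| < ip w (T x). As c |w| <= |T^* w|, this contradicts
    Cauchy-Schwarz. *)
Lemma bounded_below_adjoint (a b c : R) : 0 < a -> 0 < b ->
    bounded_below a -> adjoint_bounded_below b -> 0 < c ->
  bounded_below c <-> adjoint_bounded_below c.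
Proof.
move=> a0 b0 Ta Tb c0; split=> [Tc y M y0 yM|Tc x].
  have [x xy] := bounded_below_surj a0 b0 Ta Tb y.
  have yMx := yM x; rewrite xy ip_norm in yMx.
  have cxy := Tc x; rewrite xy in cxy.
  have y_gt0 : 0 < `|y| by rewrite normr_gt0.
  have M0 : 0 <= M.
    rewrite leNgt; apply/negP => M0.
    have : M * `|x| <= 0 by rewrite nmulr_rle0.
    by apply/negP; rewrite -ltNge (lt_le_trans _ yMx)// exprn_gt0.
  rewrite -(ler_pM2r y_gt0) -mulrA -expr2.
  apply: (le_trans (ler_wpM2l (ltW c0) yMx)).
  by rewrite mulrCA ler_wpM2l.
rewrite leNgt; apply/negP => xc.
have x0 : 0 < `|x|.
  rewrite normr_gt0; apply: contraTneq xc => ->.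
  by rewrite linear0 !normr0 mulr0 ltxx.
have Tx0 : 0 < `|T x| by apply: lt_le_trans (Ta x); rewrite mulr_gt0.
pose r := `|T x| / c.
have r0 : 0 < r by rewrite divr_gt0.
have rx : r < `|x| by rewrite ltr_pdivrMr// mulrC.
have cr : c * r = `|T x| by rewrite mulrC divfK// gt_eqF.
have [p pr pmin] : exists2 p, `|p| <= r &
    forall u, `|u| <= r -> ip (T x - T p) (T u - T p) <= 0.
  apply: (best_approximation ip_norm (T := T) (a := a)
    (D := [set u | `|u| <= r])) => //.
  - exact: blin_continuous.
  - by exists 0; rewrite /= normr0 ltW.
  - apply: (@preimage_closed _ _ (fun u : X => `|u|) [set s | s <= r]).
      by move=> u _; exact: norm_continuous.
    exact: closed_le.
  - move=> u v t /= ur vr /andP[t0 t1].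
    have -> : u + t *: (v - u) = (1 - t) *: u + t *: v.
      by rewrite scalerBl scale1r scalerBr addrA addrAC.
    apply: le_trans (ler_normD _ _) _; rewrite !normrZ (ger0_norm t0).
    rewrite ger0_norm ?subr_ge0//.
    have tv := ler_wpM2l t0 vr.
    have tu : (1 - t) * `|u| <= (1 - t) * r by rewrite ler_wpM2l ?subr_ge0.
    lra.
set w := T x - T p in pmin.
have w0 : w != 0.
  apply: contraTneq rx => /eqP; rewrite -leNgt /w -linearB /= => /eqP Txp.
  have := Ta (x - p); rewrite Txp normr0 pmulr_rle0// normr_le0 subr_eq0.
  by move=> /eqP ->.
(* by scaling, the supremum of ip w (T u) over the ball, attained at p,
   bounds the functional T^* w *)
have wM u : ip (T u) w <= ip w (T p) / r * `|u|.
  have [->|u0] := eqVneq u 0; first by rewrite linear0 linear0l normr0 mulr0.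
  have nu : 0 < `|u| by rewrite normr_gt0.
  have ru : `|(r / `|u|) *: u| <= r.
    rewrite normrZ ger0_norm; last by rewrite divr_ge0 ?(ltW r0).
    by rewrite -mulrA mulVf ?mulr1// gt_eqF.
  have := pmin _ ru; rewrite linearZ (ipBr ip) (ipZr ip) subr_le0 => h.
  rewrite (ipC ip (T u)) mulrAC ler_pdivlMr//.
  by rewrite mulrAC ler_pdivrMr// mulrC in h.
have := Tc w _ w0 wM; rewrite ler_pdivlMr// mulrAC cr leNgt => /negP; apply.
have -> : ip w (T p) = ip w (T x) - `|w| ^+ 2.
  by rewrite -ip_norm {3}/w (ipBr ip) opprB addrC subrK.
have w2 : 0 < `|w| ^+ 2 by rewrite exprn_gt0 ?normr_gt0.
have := cauchy_schwarz ip_norm w (T x); lra.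
Qed.

End AdjointPair.

(** * Inf-sup constants *)

Section InfSup.
Variable R : realType.

(** Stated through all the bounds M of b u, so that the supremum may be
    infinite. A nonzero vector in V keeps it from being the supremum of the
    empty set. *)
Lemma le_inf_sup (U V : normedModType R) (b : U -> V -> R) (c : R) :
    (exists v : V, v != 0) -> (forall u, b u 0 = 0) ->
  (c%:E <= ereal_inf [set ereal_sup [set (b u v / (`|u| * `|v|))%R%:E
                                    | v in [set~ (0 : V)%R]]
                     | u in [set~ (0 : U)%R]])%E <->
  (forall u M, u != 0 -> (forall v, b u v <= M * `|v|) -> c * `|u| <= M).
Proof.
move=> [v0 v00] b0; split=> [cinf u M u0 uM|cM].
  have nu : 0 < `|u| by rewrite normr_gt0.
  rewrite -ler_pdivlMr// -lee_fin; apply: le_trans cinf _.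
  apply: ge_ereal_inf; exists (ereal_sup [set (b u v / (`|u| * `|v|))%R%:E
                                    | v in [set~ (0 : V)%R]]).
    by exists u => //; exact/eqP.
  apply: ge_ereal_sup => _ [v /eqP v_neq0 <-]; rewrite lee_fin.
  have nv : 0 < `|v| by rewrite normr_gt0.
  by rewrite invfM mulrA ler_pdivrMr// mulrAC ler_pM2r ?invr_gt0// mulrC.
apply: le_ereal_inf_tmp => _ [u /eqP u0 <-].
have nu : 0 < `|u| by rewrite normr_gt0.
set S := [set _ | v in _].
have Sle v : v != 0 -> ((b u v / (`|u| * `|v|))%R%:E <= ereal_sup S)%E.
  by move=> v_neq0; apply: ereal_sup_ubound; exists v => //; exact/eqP.
case: (ereal_sup S) Sle => [s|_|/(_ v0 v00)] //; last by rewrite leey.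
move=> sup_s; rewrite lee_fin -(ler_pM2r nu); apply: cM => // v.
have [->|v_neq0] := eqVneq v 0; first by rewrite b0 normr0 mulr0.
have := sup_s v v_neq0; rewrite lee_fin ler_pdivrMr ?mulr_gt0 ?normr_gt0//.
by rewrite mulrA.
Qed.

(** An extended real at least m is the supremum of the reals between m and it. *)
Lemma eq_ereal_cuts (a b : \bar R) (m : R) :
    (m%:E <= a)%E -> (m%:E <= b)%E ->
    (forall c : R, m <= c -> (c%:E <= a)%E <-> (c%:E <= b)%E) -> a = b.
Proof.
have half x y : (m%:E <= x)%E ->
    (forall c : R, m <= c -> (c%:E <= x)%E -> (c%:E <= y)%E) -> (x <= y)%E.
  case: x => [r| |] mx h; last by rewrite leNye.
    by apply: h; rewrite -?lee_fin.
  rewrite leye_eq; apply/eqP/eqyP => A A0.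
  apply: le_trans (h (Num.max A m) _ (leey _)).
    by rewrite lee_fin le_max lexx.
  by rewrite le_max lexx orbT.
move=> ma mb ab; apply/eqP; rewrite eq_le; apply/andP; split.
  by apply: half => // c mc /(ab c mc).
by apply: half => // c mc /(ab c mc).
Qed.

End InfSup.

(** * The equivalence *)

Theorem proposition2p7 (R : realType)
    (X : completeNormedModType R)
    (X_neq0 : exists x : X, x != 0)
    (X_separable : separable X)
    (X_reflexive : reflexive_space X)
    (Y : completeNormedModType R)
    (ip : {dot Y for (idfun : R -> R)})
    (ip_norm : forall y : Y, ip y y = `|y| ^+ 2)
    (Y_neq0 : exists y : Y, y != 0)
    (Y_separable : separable Y)
    (A : 'L(X, dual Y)) :
  (exists gamma : R, [/\ 0 < gamma,
     ereal_inf [set ereal_sup [set (pairing (A x) y / (`|x| * `|y|))%:E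
                              | x in [set~ (0 : X)]]
               | y in [set~ (0 : Y)]] = gamma%:E
   & ereal_inf [set ereal_sup [set (pairing (A x) y / (`|x| * `|y|))%:E
                              | y in [set~ (0 : Y)]]
               | x in [set~ (0 : X)]] = gamma%:E])
  <->
  (exists Phi : 'L(X, Y),
     (forall y : Y, exists x : X, Phi x = y) /\
     limf_einf (fun x : X => (pairing (A x) (Phi x) / `|x|)%:E)
       (@norm_infty R X) = +oo%E).
Proof.
have [T TA] := riesz_operator ip_norm A.
set infsupY := ereal_inf _; set infsupX := ereal_inf _.
have infsupYP c : (c%:E <= infsupY)%E <-> adjoint_bounded_below ip T c.
  rewrite (_ : infsupY = ereal_inf
      [set ereal_sup [set (ip (T x) y / (`|y| * `|x|))%:E | x in [set~ (0 : X)]]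
      | y in [set~ (0 : Y)]]).
    apply: (le_inf_sup (b := fun y x => ip (T x) y)) => // y.
    by rewrite linear0 linear0l.
  congr ereal_inf; apply: eq_imagel => y _; congr ereal_sup.
  by apply: eq_imagel => x _; rewrite TA [`|x| * _]mulrC.
have infsupXP c : (c%:E <= infsupX)%E <-> bounded_below T c.
  rewrite (bounded_belowP ip_norm)//.
  rewrite (_ : infsupX = ereal_inf
      [set ereal_sup [set (ip (T x) y / (`|x| * `|y|))%:E | y in [set~ (0 : Y)]]
      | x in [set~ (0 : X)]]).
    apply: (le_inf_sup (b := fun x y => ip (T x) y)) => // x.
    by rewrite linear0r.
  congr ereal_inf; apply: eq_imagel => x _; congr ereal_sup.
  by apply: eq_imagel => y _; rewrite TA.
split=> [[gamma [gamma0 Yg Xg]]|[Phi [Phi_surj /liminf_quotient_normP coer]]].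
  have Tg : bounded_below T gamma by apply/infsupXP; rewrite Xg.
  have Tg' : adjoint_bounded_below ip T gamma by apply/infsupYP; rewrite Yg.
  exists T; split.
    exact: (bounded_below_surj ip_norm gamma0 gamma0 Tg Tg').
  apply/liminf_quotient_normP => K K0.
  exists (K / gamma ^+ 2) => [|x]; first by rewrite divr_gt0 ?exprn_gt0.
  rewrite TA ip_norm ler_pdivrMr ?exprn_gt0// => Kx.
  apply: (@le_trans _ _ ((gamma * `|x|) ^+ 2)).
    rewrite exprMn mulrC [X in _ <= _ * X]expr2 mulrA mulrC.
    by rewrite ler_wpM2r// mulrC.
  by rewrite ler_pXn2r ?nnegrE ?mulr_ge0 ?(ltW gamma0).
have [r r0 rcoer] := coer 1 ltr01.
pose B := opnorm Phi + 1.
have B0 : 0 < B by rewrite ltr_wpDl ?opnorm_ge0.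
have PhiB x : `|Phi x| <= B * `|x|.
  by apply: le_trans (ler_opnorm _ _) _; rewrite ler_wpM2r// lerDl.
(* the growth condition at the multiple of x of norm r, by homogeneity *)
have ell x : `|x| ^+ 2 <= r * ip (T x) (Phi x).
  have [->|x0] := eqVneq x 0.
    by rewrite linear0 linear0l normr0 expr0n /= mulr0.
  have nx : 0 < `|x| by rewrite normr_gt0.
  have ru : `|(r / `|x|) *: x| = r.
    rewrite normrZ ger0_norm; last by rewrite divr_ge0 ?(ltW r0).
    by rewrite -mulrA mulVf ?mulr1// gt_eqF.
  have := rcoer ((r / `|x|) *: x); rewrite ru lexx => /(_ isT).
  rewrite TA [T _]linearZ [Phi _]linearZ (ipZl ip) (ipZr ip) mul1r.
  have -> : r / `|x| * (r / `|x| * ip (T x) (Phi x)) =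
      r * (r * ip (T x) (Phi x) / `|x| ^+ 2).
    by field; rewrite gt_eqF.
  by rewrite ler_pMr// ler_pdivlMr ?mul1r// exprn_gt0.
pose m := (r * B)^-1.
have m0 : 0 < m by rewrite invr_gt0 mulr_gt0.
have Tm : bounded_below T m.
  move=> x; have [->|x0] := eqVneq x 0; first by rewrite linear0 !normr0 mulr0.
  have nx : 0 < `|x| by rewrite normr_gt0.
  rewrite mulrC ler_pdivrMr ?mulr_gt0// -(ler_pM2r nx) -expr2.
  apply: le_trans (ell x) _.
  have -> : `|T x| * (r * B) * `|x| = r * (`|T x| * (B * `|x|)) by ring.
  rewrite ler_pM2l//; apply: le_trans (cauchy_schwarz ip_norm _ _) _.
  by rewrite ler_wpM2l.
have Tm' : adjoint_bounded_below ip T m.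
  move=> y M y0 yM; have [x xy] := Phi_surj y.
  have nx : 0 < `|x|.
    by rewrite normr_gt0; apply: contra_neq y0 => x0; rewrite -xy x0 linear0.
  rewrite mulrC ler_pdivrMr ?mulr_gt0// -xy; apply: le_trans (PhiB x) _.
  rewrite mulrA mulrC ler_pM2r// [M * r]mulrC -(ler_pM2r nx) -expr2 -mulrA.
  by apply: le_trans (ell x) _; rewrite ler_pM2l// xy.
have eqinf : infsupY = infsupX.
  apply: (@eq_ereal_cuts _ _ _ m); [exact/infsupYP|exact/infsupXP|].
  move=> c mc; rewrite infsupYP infsupXP; apply: iff_sym.
  exact: (bounded_below_adjoint ip_norm m0 m0 Tm Tm' (lt_le_trans m0 mc)).
(* the common value is finite, as |T x0| / |x0| bounds it *)
have [x0 x0_neq0] := X_neq0.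
have infX_fin : infsupX \is a fin_num.
  rewrite fin_numE; apply/andP; split.
    by apply: contraTneq (proj2 (infsupXP m) Tm) => ->.
  apply/eqP => infXy.
  have /infsupXP/(_ x0) : ((`|T x0| / `|x0| + 1)%:E <= infsupX)%E.
    by rewrite infXy leey.
  by rewrite mulrDl mul1r divfK ?normr_eq0// gerDl leNgt normr_gt0 x0_neq0.
exists (fine infsupX); rewrite eqinf fineK//; split=> //.
rewrite -lte_fin fineK//; apply: lt_le_trans (proj2 (infsupXP m) Tm).
by rewrite lte_fin.
Qed.
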